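(* Let $f\colon K\to L$ be a simplicial map between finite connected simplicial complexes and let $n\ge 0$ be an integer. Then $\mathrm{scat}(f)\leq n$ if and only if there exist a finite connected simplicial complex $K'$ with $\mathrm{gscat}(K')\leq n$ and simplicial maps $\ell\colon K\to K'$ and $g\colon K'\to L$ such that $g\circ \ell\sim f$.
   Context: Simplicial complexes are abstract, finite and (edge-path) connected; subcomplexes of a given complex (e.g. members of covers) are not required to be connected. A simplicial map $f\colon K\to L$ is a map of vertex sets sending simplices to simplices. Simplicial maps $f,g\colon K\to L$ are contiguous, $f\sim_c g$, if $f(\sigma)\cup g(\sigma)$ is a simplex of $L$ for every simplex $\sigma$ of $K$. They are in the same contiguity class, $f\sim g$, if there are simplicial maps $f=f_0\sim_c f_1\sim_c\cdots\sim_c f_m=g$ from $K$ to $L$. The symbol $*$ denotes a map sending every vertex to a single vertex of the codomain; $f\sim *$ means $f\sim c$ for some such constant map $c$. $\mathrm{scat}(f)$ is the least integer $n\ge 0$ such that $K$ is a union of subcomplexes $U_0,\dots,U_n$ with $f|_{U_j}\sim *$ (as maps $U_j\to L$) for all $0\le j\le n$. $\mathrm{gscat}(K)$ is the least integer $m\geq 0$ such that $K$ is a union of subcomplexes $U_0,\dots,U_m$ with $\mathrm{id}_{U_j}\sim *$ (as maps $U_j\to U_j$) for all $0\le j\le m$. *)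

(* Defs.v *)
From mathcomp Require Import all_boot.
From mathcomp Require Import boolp.
Set Implicit Arguments. Unset Strict Implicit. Unset Printing Implicit Defensive.

(* A complex is its set of (nonempty) simplices.  The vertices of K are the
   v : V with [set v] \in K; other elements of V are not vertices of K.  This
   lets a subcomplex of K live over the same V without containing all the
   vertices of K.  The empty complex is allowed at this level, since members
   of covers are arbitrary subcomplexes. *)
Record scomplex (V : finType) := SComplex {
  simplices :> {set {set V}};
  set0_notin : set0 \notin simplices;
  face_closed : forall s t : {set V},
    s \in simplices -> t \subset s -> t != set0 -> t \in simplices }.

Definition vertices (V : finType) (K : scomplex V) : {set V} :=
  [set v | [set v] \in (K : {set {set V}})].

Definition edge_path_connected (V : finType) (K : scomplex V) : Prop :=
  vertices K != set0 /\
  {in vertices K &, forall u v,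
     connect (fun x y => [set x; y] \in (K : {set {set V}})) u v}.

Record subcomplex (V : finType) (K : scomplex V) := SubComplex {
  subc :> scomplex V;
  subcP : (subc : {set {set V}}) \subset (K : {set {set V}}) }.

Definition simplicial (V W : finType) (K : scomplex V) (L : scomplex W)
    (f : {ffun V -> W}) : bool :=
  [forall s in (K : {set {set V}}), f @: s \in (L : {set {set W}})].

(* Only the values of f on vertices of K are meaningful.  Two maps that agree
   on the vertices of K are contiguous, so the values elsewhere do not affect
   contiguity classes. *)
Record smap (V W : finType) (K : scomplex V) (L : scomplex W) := SMap {
  smap_fun :> {ffun V -> W};
  smapP : simplicial K L smap_fun }.

Section Maps.
Context (V W X : finType) (K : scomplex V) (L : scomplex W) (M : scomplex X).

Lemma simplicial_id : simplicial K K [ffun v => v].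
Proof.
apply/forall_inP => s sK; rewrite (_ : _ @: s = s) //.
by rewrite -[RHS]imset_id; apply: eq_imset => v; rewrite ffunE.
Qed.
Definition smap_id : smap K K := SMap simplicial_id.

Lemma simplicial_comp (g : smap L M) (f : smap K L) :
  simplicial K M [ffun v => g (f v)].
Proof.
apply/forall_inP => s sK; rewrite (_ : _ @: s = g @: (f @: s)).
  exact: (forall_inP (smapP g)) (forall_inP (smapP f) _ sK).
by rewrite -imset_comp; apply: eq_imset => v; rewrite ffunE.
Qed.
Definition smap_comp (g : smap L M) (f : smap K L) : smap K M :=
  SMap (simplicial_comp g f).

Lemma simplicial_restr (f : smap K L) (U : subcomplex K) : simplicial U L f.
Proof.
apply/forall_inP => s sU.
exact: (forall_inP (smapP f)) (subsetP (subcP U) _ sU).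
Qed.
Definition smap_restr (f : smap K L) (U : subcomplex K) : smap U L :=
  SMap (simplicial_restr f U).

Definition contiguous (f g : smap K L) : bool :=
  [forall s in (K : {set {set V}}),
     (f @: s) :|: (g @: s) \in (L : {set {set W}})].

Definition contiguity_class (f g : smap K L) : Prop :=
  exists2 h : seq (smap K L), path contiguous f h & last f h = g.

Definition constant_smap (c : smap K L) : Prop :=
  exists2 w, w \in vertices L & {in vertices K, forall v, c v = w}.

Definition null_smap (f : smap K L) : Prop :=
  exists2 c : smap K L, constant_smap c & contiguity_class f c.

End Maps.

Definition covers (V : finType) (K : scomplex V) (n : nat)
    (U : 'I_n.+1 -> subcomplex K) : Prop :=
  \bigcup_(j < n.+1) (U j : {set {set V}}) = K :> {set {set V}}.

Definition scat_cover (V W : finType) (K : scomplex V) (L : scomplex W)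
    (f : smap K L) (n : nat) : Prop :=
  exists2 U : 'I_n.+1 -> subcomplex K,
    covers U & forall j, null_smap (smap_restr f (U j)).

Definition gscat_cover (V : finType) (K : scomplex V) (n : nat) : Prop :=
  exists2 U : 'I_n.+1 -> subcomplex K,
    covers U & forall j, null_smap (smap_id (U j)).

(* The least n satisfying P.  The value 0 for an unsatisfiable P is never used
   on connected complexes: see scat_coverP and gscat_coverP below. *)
Definition least (P : nat -> Prop) : nat :=
  match pselect (exists n, `[< P n >]) with
  | left exP => ex_minn exP
  | right _ => 0
  end.

Definition scat (V W : finType) (K : scomplex V) (L : scomplex W)
    (f : smap K L) : nat := least (scat_cover f).

Definition gscat (V : finType) (K : scomplex V) : nat := least (gscat_cover K).

Lemma leastP (P : nat -> Prop) : (exists n, P n) ->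
  P (least P) /\ forall n, P n -> least P <= n.
Proof.
move=> [n Pn]; rewrite /least; case: pselect => [exP|nP]; last first.
  by case: nP; exists n; apply/asboolP.
case: ex_minnP => m /asboolP Pm mP; split=> // k Pk.
by apply: mP; apply/asboolP.
Qed.

Section Existence.
Context (V : finType) (K : scomplex V).

Lemma closed_simplex_set0 (s : {set V}) :
  set0 \notin [set t in (K : {set {set V}}) | t \subset s].
Proof. by rewrite inE (negbTE (set0_notin K)). Qed.

Lemma closed_simplex_face (s t u : {set V}) :
  t \in [set t in (K : {set {set V}}) | t \subset s] -> u \subset t ->
  u != set0 -> u \in [set t in (K : {set {set V}}) | t \subset s].
Proof.
rewrite !inE => /andP[tK ts] ut u0.
by rewrite (face_closed tK ut u0) (subset_trans ut ts).
Qed.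

Lemma closed_simplex_sub (s : {set V}) :
  SComplex (closed_simplex_set0 s) (@closed_simplex_face s)
    \subset (K : {set {set V}}).
Proof. by apply/subsetP => t; rewrite inE => /andP[]. Qed.

Definition closed_simplex (s : {set V}) : subcomplex K :=
  SubComplex (closed_simplex_sub s).

Lemma null_closed_simplex (W : finType) (L : scomplex W) (s : {set V})
    (f : smap (closed_simplex s) L) : s \in (K : {set {set V}}) -> null_smap f.
Proof.
move=> sK; have sD : s \in (closed_simplex s : {set {set V}}).
  by rewrite inE sK subxx.
have fsL := forall_inP (smapP f) _ sD.
have [v vs] : exists v, v \in s.
  by apply/set0Pn; apply: contraNneq (set0_notin K) => <-.
have s1 t : t \in (closed_simplex s : {set {set V}}) ->
    (f @: t) :|: ([ffun=> f v] @: t) \in (L : {set {set W}}).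
  move=> tD; apply: (face_closed fsL).
    apply/subUsetP; split; last first.
      by apply/subsetP => _ /imsetP[x _ ->]; rewrite ffunE imset_f.
    by apply: imsetS; move: tD; rewrite inE => /andP[].
  have /set0Pn[x xt] : t != set0.
    by apply: contraNneq (set0_notin (closed_simplex s)) => <-.
  by apply/set0Pn; exists (f x); rewrite inE imset_f.
have sc : simplicial (closed_simplex s) L [ffun=> f v].
  apply/forall_inP => t tD; apply: (face_closed (s1 t tD)) (subsetUr _ _) _.
  have /set0Pn[x xt] : t != set0.
    by apply: contraNneq (set0_notin (closed_simplex s)) => <-.
  by apply/set0Pn; exists ([ffun=> f v] x); rewrite imset_f.
exists (SMap sc).
  exists (f v); last by move=> x _; rewrite ffunE.
  rewrite inE; apply: (face_closed fsL); first by rewrite sub1set imset_f.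
  by apply/set0Pn; exists (f v); rewrite inE.
by exists [:: SMap sc] => //=; rewrite andbT; apply/forall_inP.
Qed.

Lemma simplices_cover : edge_path_connected K ->
  exists n, exists2 s : 'I_n.+1 -> {set V},
    forall j, s j \in (K : {set {set V}}) &
    covers (fun j => closed_simplex (s j)).
Proof.
case=> /set0Pn[v0]; rewrite inE => v0K _.
have Kpos : 0 < size (enum K).
  by rewrite -cardE; apply/card_gt0P; exists [set v0].
exists (size (enum K)).-1.
exists (fun j => nth [set v0] (enum K) j).
  by move=> j; rewrite -mem_enum mem_nth // -[ltnRHS]prednK.
apply/setP => t; apply/bigcupP/idP => [[j _]|tK].
  by rewrite inE => /andP[].
have tE : t \in enum K by rewrite mem_enum.
have it : index t (enum K) < (size (enum K)).-1.+1.
  by rewrite prednK // index_mem.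
by exists (Ordinal it) => //; rewrite inE tK /= nth_index.
Qed.

Lemma scat_coverP (W : finType) (L : scomplex W) (f : smap K L) :
  edge_path_connected K ->
  scat_cover f (scat f) /\ forall n, scat_cover f n -> scat f <= n.
Proof.
move=> /simplices_cover[n [s sK Us]]; apply: leastP; exists n.
by exists (fun j => closed_simplex (s j)) => // j; apply: null_closed_simplex.
Qed.

Lemma gscat_coverP : edge_path_connected K ->
  gscat_cover K (gscat K) /\ forall n, gscat_cover K n -> gscat K <= n.
Proof.
move=> /simplices_cover[n [s sK Us]]; apply: leastP; exists n.
by exists (fun j => closed_simplex (s j)) => // j; apply: null_closed_simplex.
Qed.

End Existence.

(* Main.v *)
Require Import Defs.
From mathcomp Require Import all_boot.
From mathcomp Require Import boolp zify.
Set Implicit Arguments. Unset Strict Implicit. Unset Printing Implicit Defensive.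

(** If [id ~ *] on each member of a cover of [K'], then [g \o l ~ *] on the
    preimages under [l] of these members, and [f ~ g \o l].

    Conversely, let [U_0, ..., U_m] cover [K], and let [F j 0, F j 1, ...] be a
    sequence of contiguous maps [U_j -> L] from [f] to the constant [w_j].  Take
    for [K'] the union of the long cones on the [U_j] (the categorical product
    of [U_j] with a path, its last level collapsed to an apex), glued together
    along their copies of [K] at level 0.  Raising the levels one at a time
    contracts each long cone to its apex within itself, and the maps [F j k] on
    the levels of the cones extend [f] to [g : K' -> L]. *)

(** * Contiguity classes of simplicial maps *)

Section ContiguityClasses.
Context (V W : finType) (K : scomplex V) (L : scomplex W).
Implicit Types f g h : smap K L.

Lemma smap_inj f g : smap_fun f = smap_fun g -> f = g.
Proof.
case: f g => [f fP] [g gP] /= fg; rewrite fg in fP *.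
by rewrite (bool_irrelevance fP gP).
Qed.

Lemma simplex_neq0 (s : {set V}) : s \in (K : {set {set V}}) -> s != set0.
Proof. by apply: contraTneq => ->; apply: set0_notin. Qed.

Lemma simplex_vertex (s : {set V}) v :
  s \in (K : {set {set V}}) -> v \in s -> v \in vertices K.
Proof.
move=> sK vs; rewrite inE; apply: (face_closed sK); first by rewrite sub1set.
by rewrite -card_gt0 cards1.
Qed.

Lemma smap_vertex f v : v \in vertices K -> f v \in vertices L.
Proof. by rewrite !inE -imset_set1 => /(forall_inP (smapP f)). Qed.

Lemma contiguous_refl f : contiguous f f.
Proof. by apply/forall_inP => s sK; rewrite setUid (forall_inP (smapP f)). Qed.

Lemma contiguous_sym f g : contiguous f g = contiguous g f.
Proof. by apply: eq_forallb => s; rewrite setUC. Qed.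

Lemma contiguity_class_trans f g h :
  contiguity_class f g -> contiguity_class g h -> contiguity_class f h.
Proof.
case=> [p fp lp] [q gq lq]; exists (p ++ q); first by rewrite cat_path fp lp.
by rewrite last_cat lp.
Qed.

Lemma contiguity_class_sym f g : contiguity_class f g -> contiguity_class g f.
Proof.
case=> p fp <-; exists (rev (belast f p)).
  by rewrite rev_path; apply: sub_path fp => x y; rewrite contiguous_sym.
by case: p fp => //= x p _; rewrite rev_cons last_rcons.
Qed.

Lemma contiguity_class_nat (F : nat -> smap K L) n :
  (forall k, contiguous (F k) (F k.+1)) -> contiguity_class (F 0) (F n).
Proof.
move=> cF; elim: n => [|n IHn]; first by exists [::].
by apply: contiguity_class_trans IHn _; exists [:: F n.+1]; rewrite //= cF.
Qed.

(** The finite chain is prolonged by repeating [g] forever, so that chains of different lengths can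
    later be cut at one common level. *)
Lemma contiguity_class_natP f g : contiguity_class f g ->
  exists2 F : nat -> smap K L, forall k, contiguous (F k) (F k.+1) &
    F 0 = f /\ exists n, forall k, n <= k -> F k = g.
Proof.
case=> p; elim: p f => [|h p IHp] f /=.
  move=> _ <-; exists (fun=> f); first by move=> _; apply: contiguous_refl.
  by split; last exists 0.
case/andP=> fh /IHp{}IHp /IHp[F cF [F0 [n Fn]]].
exists (fun k => if k is i.+1 then F i else f); last first.
  by split=> //; exists n.+1; case.
by case=> [|k]; rewrite ?F0.
Qed.

End ContiguityClasses.

Lemma contiguity_class_homo (V W V' W' : finType) (K : scomplex V)
    (L : scomplex W) (K' : scomplex V') (L' : scomplex W')
    (Phi : smap K L -> smap K' L') (f g : smap K L) :
  (forall f g, contiguous f g -> contiguous (Phi f) (Phi g)) ->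
  contiguity_class f g -> contiguity_class (Phi f) (Phi g).
Proof.
move=> homo [p fp <-]; exists (map Phi p); last by rewrite last_map.
by rewrite path_map; apply: sub_path fp => x y /homo.
Qed.

(** * Pulling covers back along a simplicial map *)

Section Preimage.
Context (V W : finType) (K : scomplex V) (L : scomplex W).
Context (l : smap K L) (U : subcomplex L).

Let preim : {set {set V}} :=
  [set s in (K : {set {set V}}) | l @: s \in (U : {set {set W}})].

Lemma preim_set0 : set0 \notin preim.
Proof. by rewrite inE (negbTE (set0_notin K)). Qed.

Lemma preim_face (s t : {set V}) :
  s \in preim -> t \subset s -> t != set0 -> t \in preim.
Proof.
rewrite !inE => /andP[sK lsU] ts t0; rewrite (face_closed sK ts t0) /=.
by apply: (face_closed lsU); rewrite ?imsetS // imset_eq0.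
Qed.

Lemma preim_sub : SComplex preim_set0 preim_face \subset (K : {set {set V}}).
Proof. by apply/subsetP => s; rewrite inE => /andP[]. Qed.

Definition preim_subcomplex : subcomplex K := SubComplex preim_sub.

Lemma simplicial_preim : simplicial preim_subcomplex U l.
Proof. by apply/forall_inP => s; rewrite inE => /andP[]. Qed.

Definition smap_preim : smap preim_subcomplex U := SMap simplicial_preim.

End Preimage.

Section Factorization.
Context (V W X : finType) (K : scomplex V) (L : scomplex W) (M : scomplex X).
Context (l : smap K M) (g : smap M L).

(** Composing with [g] and [l] carries contiguities between self-maps of [U] to contiguities between
    maps from the preimage to [L]. It sends the identity to a restriction of [g \o l], and a
    constant to a constant. *)
Lemma null_smap_preim (f : smap K L) (U : subcomplex M) :
  contiguity_class (smap_comp g l) f -> null_smap (smap_id U) ->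
  null_smap (smap_restr f (preim_subcomplex l U)).
Proof.
move=> glf [c [w wU cw] idc].
pose Phi (h : smap U U) :=
  smap_comp (smap_comp (smap_restr g U) h) (smap_preim l U).
exists (Phi c).
  exists (g w); first exact: (smap_vertex (smap_restr g U)).
  move=> v vP; rewrite !ffunE /= cw //; exact: (smap_vertex (smap_preim l U)).
apply: contiguity_class_trans (contiguity_class_homo (Phi := Phi) _ idc);
  last first.
  move=> h h' /forall_inP hh'; apply/forall_inP => s sP /=.
  have lsU := forall_inP (smapP (smap_preim l U)) _ sP.
  have PhiE k : Phi k @: s = g @: (k @: (l @: s)).
    by rewrite -!imset_comp; apply: eq_imset => v; rewrite /= !ffunE.
  by rewrite !PhiE -imsetU (forall_inP (smapP (smap_restr g U))) ?hh'.
have -> : Phi (smap_id U) = smap_restr (smap_comp g l) (preim_subcomplex l U).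
  by apply: smap_inj; apply/ffunP => v; rewrite !ffunE.
apply: contiguity_class_sym.
apply: (contiguity_class_homo (Phi := fun h => smap_restr h _)) glf => h h'.
move=> /forall_inP hh'; apply/forall_inP => s sP.
exact: hh' (subsetP (subcP (preim_subcomplex l U)) _ sP).
Qed.

Lemma scat_cover_factor (f : smap K L) n :
  contiguity_class (smap_comp g l) f -> gscat_cover M n -> scat_cover f n.
Proof.
move=> glf [U covU nullU]; exists (fun j => preim_subcomplex l (U j)).
  apply/setP => s; apply/bigcupP/idP => [[j _]|sK].
    by rewrite inE => /andP[].
  have := forall_inP (smapP l) _ sK; rewrite -covU => /bigcupP[j _ lsU].
  by exists j => //; rewrite inE sK.
by move=> j; apply: null_smap_preim.
Qed.

End Factorization.

(** * Complexes generated by a family of sets *)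

Section Generated.
Context (V : finType).

Section Complex.
Context (G : {set {set V}}).

Let gen : {set {set V}} := [set s | (s != set0) && [exists t in G, s \subset t]].

Lemma generated_set0 : set0 \notin gen.
Proof. by rewrite inE eqxx. Qed.

Lemma generated_face (s t : {set V}) :
  s \in gen -> t \subset s -> t != set0 -> t \in gen.
Proof.
rewrite !inE => /andP[_ /exists_inP[r rG sr]] ts ->.
by apply/exists_inP; exists r; rewrite // (subset_trans ts).
Qed.

Definition generated : scomplex V := SComplex generated_set0 generated_face.

Lemma generatedP (s : {set V}) :
  reflect (s != set0 /\ exists2 t, t \in G & s \subset t)
    (s \in (generated : {set {set V}})).
Proof.
rewrite inE; apply: (iffP andP) => [[s0 /exists_inP sG]|[s0 sG]] //.
by split=> //; apply/exists_inP.
Qed.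

Context (W : finType) (L : scomplex W).

Lemma simplicial_generated (f : {ffun V -> W}) :
  (forall t, t \in G -> f @: t \in (L : {set {set W}})) ->
  simplicial generated L f.
Proof.
move=> fG; apply/forall_inP => s /generatedP[s0 [t tG st]].
by apply: (face_closed (fG t tG)); rewrite ?imsetS // imset_eq0.
Qed.

Lemma contiguous_generated (f g : smap generated L) :
  (forall t, t \in G -> f @: t :|: g @: t \in (L : {set {set W}})) ->
  contiguous f g.
Proof.
move=> fgG; apply/forall_inP => s /generatedP[s0 [t tG st]].
apply: (face_closed (fgG t tG)); first by rewrite setUSS ?imsetS.
by rewrite setU_eq0 imset_eq0 (negbTE s0).
Qed.

End Complex.

Lemma generated_sub (G H : {set {set V}}) :
  G \subset H -> generated G \subset (generated H : {set {set V}}).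
Proof.
move=> /subsetP GH; apply/subsetP => s /generatedP[s0 [t /GH tH st]].
by apply/generatedP; split=> //; exists t.
Qed.

End Generated.

(** * Long cones glued along level 0 *)

Section LongCones.
Context (V : finType) (K : scomplex V) (m N : nat) (v0 : V).
Context (U : 'I_m.+1 -> subcomplex K).
Context (N_gt0 : 0 < N).

Let VV : finType := ('I_m.+1 * 'I_N.+1 * V)%type.

(* The vertex over [v] at level [k] of the [j]-th cone.  Level 0 does not
   depend on [j], and the levels from [N] on are a single point. *)
Definition lev (j : 'I_m.+1) (k : nat) (v : V) : VV :=
  (if k == 0 then ord0 else j, inord (minn k N), if N <= k then v0 else v).

(** In the categorical product the whole prism over [t] and an edge of the path is one simplex. A
    map given by [F j k] on level [k] sends it to a simplex exactly by the contiguity condition on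
    [F j k] and [F j k.+1]. *)
Definition slab j k (t : {set V}) : {set VV} :=
  lev j k @: t :|: lev j k.+1 @: t.

Definition slabs j : {set {set VV}} :=
  [set slab j (k : 'I_N.+1) t | k in 'I_N.+1, t in (U j : {set {set V}})].

Definition cones : scomplex VV := generated (\bigcup_j slabs j).

Definition long_cone j : subcomplex cones :=
  SubComplex (generated_sub (bigcup_sup j (F := slabs) isT)).

(** As [N > 0], the apex is off level 0, where the index [j] is forgotten. *)
Lemma lev_top j k v : N <= k -> lev j k v = lev j N v0.
Proof.
move=> Nk; rewrite /lev Nk (minn_idPr Nk) leqnn minnn !gtn_eqF //.
exact: leq_trans Nk.
Qed.

(** From level [N] on every slab is the apex alone, so [k] can range over all naturals. *)
Lemma slab_in j k t :
  t \in (U j : {set {set V}}) -> slab j k t \in slabs j.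
Proof.
move=> tU; have [kN|Nk] := ltnP k N.+1.
  by apply/imset2P; exists (Ordinal kN) t.
apply/imset2P; exists ord_max t => //; rewrite /slab; congr (_ :|: _).
  by apply: eq_imset => v; rewrite !lev_top // ltnW.
by apply: eq_imset => v; rewrite !lev_top //=; lia.
Qed.

Lemma slab_neq0 j k t : t \in (U j : {set {set V}}) -> slab j k t != set0.
Proof. by move=> tU; rewrite setU_eq0 !imset_eq0 (negbTE (simplex_neq0 tU)). Qed.

Lemma mem_long_cone j k t s : t \in (U j : {set {set V}}) -> s != set0 ->
  s \subset slab j k t -> s \in (long_cone j : {set {set VV}}).
Proof.
by move=> tU s0 st; apply/generatedP; split=> //; exists (slab j k t);
  rewrite ?slab_in.
Qed.

Lemma slabsP j (A : {set VV}) :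
  A \in slabs j -> exists k t, t \in (U j : {set {set V}}) /\ A = slab j k t.
Proof. by case/imset2P=> k t _ tU ->; exists k, t. Qed.

Lemma long_cone_cover : covers long_cone.
Proof.
apply/setP => s; apply/bigcupP/idP => [[j _]|].
  exact: (subsetP (subcP (long_cone j))).
case/generatedP=> s0 [t /bigcupP[j _ tj] st].
by exists j => //; apply/generatedP; split=> //; exists t.
Qed.

(** Raises the levels below [p] to [p]. The index comes from [j], because a vertex at level 0
    carries [ord0]. *)
Definition push j p : {ffun VV -> VV} :=
  [ffun x : VV => lev j (maxn x.1.2 p) x.2].

Lemma push_lev j p k v : push j p (lev j k v) = lev j (maxn k p) v.
Proof.
rewrite ffunE /= inordK ?ltnS ?geq_minr //; have [Nk|//] := leqP N k.
by rewrite [LHS]lev_top ?[RHS]lev_top ?leq_max ?Nk ?leqnn.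
Qed.

(** The maximum of [k] or [k.+1] with [p] or [p.+1] is always [maxn k p] or its successor, so all
    four images lie in a single slab. *)
Lemma push_slab j p k t :
  push j p @: slab j k t :|: push j p.+1 @: slab j k t \subset
    slab j (maxn k p) t.
Proof.
have lev_slab i v : v \in t -> (i == maxn k p) || (i == (maxn k p).+1) ->
    lev j i v \in slab j (maxn k p) t.
  by move=> vt /orP[]/eqP->; rewrite inE imset_f ?orbT.
rewrite {1 2}/slab !imsetU -!imset_comp !subUset -andbA; apply/and4P; split;
  apply/subsetP => _ /imsetP[v vt ->]; rewrite /= push_lev lev_slab //; lia.
Qed.

Lemma push_slab_in j p k t : t \in (U j : {set {set V}}) ->
  push j p @: slab j k t :|: push j p.+1 @: slab j k t
    \in (long_cone j : {set {set VV}}).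
Proof.
move=> tU; apply: (mem_long_cone tU) (push_slab _ _ _ _).
by rewrite setU_eq0 !imset_eq0 (negbTE (slab_neq0 _ tU)).
Qed.

Lemma simplicial_push j p : simplicial (long_cone j) (long_cone j) (push j p).
Proof.
apply: simplicial_generated => _ /slabsP[k [t [tU ->]]].
apply: (face_closed (push_slab_in p k tU)); first exact: subsetUl.
by rewrite imset_eq0 slab_neq0.
Qed.

Definition push_smap j p : smap (long_cone j) (long_cone j) :=
  SMap (simplicial_push j p).

Lemma null_long_cone j :
  (U j : {set {set V}}) != set0 -> null_smap (smap_id (long_cone j)).
Proof.
(* Pushing to level [N] sends everything to the apex, which is a vertex of the cone because [U j]
   has a simplex. *)
case/set0Pn=> t tU; exists (push_smap j N).
  exists (lev j N v0).
    rewrite inE; apply: (mem_long_cone (k := N) tU).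
      by rewrite -card_gt0 cards1.
    have /set0Pn[v vt] := simplex_neq0 tU.
    by rewrite sub1set inE -(lev_top j v (leqnn N)) imset_f.
  move=> x; rewrite inE => /generatedP[_ [_ /slabsP[k [s [sU ->]]]]].
  by rewrite sub1set inE => /orP[]/imsetP[v _ ->]; rewrite /= push_lev lev_top //
    leq_maxr.
apply: contiguity_class_trans (contiguity_class_nat N _); last first.
  move=> p; apply: contiguous_generated => _ /slabsP[k [s [sU ->]]].
  exact: push_slab_in.
(* [push j 0] fixes the vertices of the cone but not all of [VV], so it is linked to the identity by
   a contiguity, not an equality. *)
exists [:: push_smap j 0] => //=; rewrite andbT.
apply: contiguous_generated => _ /slabsP[k [s [sU ->]]].
apply: (mem_long_cone (k := k) sU).
  by rewrite setU_eq0 !imset_eq0 (negbTE (slab_neq0 _ sU)).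
rewrite subUset; apply/andP; split; apply/subsetP => _ /imsetP[x xs ->].
  by rewrite ffunE.
by move: xs; rewrite inE => /orP[]/imsetP[v vs ->]; rewrite /= push_lev maxn0;
  rewrite inE imset_f ?orbT.
Qed.

Context (covU : covers U).

Lemma simplicial_base : simplicial K cones [ffun v => lev ord0 0 v].
Proof.
apply/forall_inP => s sK; move: (sK); rewrite -covU => /bigcupP[j _ sU].
(* [lev ord0 0] and [lev j 0] agree, so any cone over a [U j] containing [s] will do. *)
apply: (subsetP (subcP (long_cone j))); apply: (mem_long_cone (k := 0) sU).
  by rewrite imset_eq0 (simplex_neq0 sK).
apply: subset_trans (subsetUl _ _); apply/subsetP => _ /imsetP[v vs ->].
by apply/imsetP; exists v; rewrite // ffunE.
Qed.

Definition base : smap K cones := SMap simplicial_base.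

(** Each vertex descends through the levels of its cone to level 0, the image of the connected
    complex [K]. The [U j] themselves may be disconnected. *)
Lemma cones_connected : edge_path_connected K -> edge_path_connected cones.
Proof.
case=> /set0Pn[u0 u0K] connK; split.
  by apply/set0Pn; exists (base u0); apply: smap_vertex.
set e := (X in connect X).
have e_sym : connect_sym e by apply: sym_connect_sym => x y; rewrite /e setUC.
have down j t k v : t \in (U j : {set {set V}}) -> v \in t ->
    connect e (base v) (lev j k v).
  move=> tU vt; elim: k => [|k IHk]; first by rewrite ffunE connect0.
  apply: connect_trans IHk (connect1 _).
  apply: (subsetP (subcP (long_cone j))); apply: (mem_long_cone (k := k) tU).
    by rewrite -card_gt0 cards2.
  by rewrite subUset !sub1set !inE !imset_f ?orbT.
have base_conn u v : u \in vertices K -> v \in vertices K ->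
    connect e (base u) (base v).
  move=> uK vK; case/connectP: (connK u v uK vK) => p.
  elim: p u {uK} => [|w p IHp] u /=; first by move=> _ ->; apply: connect0.
  case/andP=> uw wp vE; apply: connect_trans (IHp w wp vE); apply: connect1.
  by have := forall_inP (smapP base) _ uw; rewrite imsetU1 imset_set1.
have to_base x : x \in vertices cones ->
    exists2 v, v \in vertices K & connect e (base v) x.
  rewrite inE => /generatedP[_ [_ /bigcupP[j _ /slabsP[k [t [tU ->]]]]]].
  have tK := subsetP (subcP (U j)) _ tU.
  by rewrite sub1set inE => /orP[]/imsetP[v vt ->]; exists v;
    rewrite ?(simplex_vertex tK) // (down j t).
move=> x y /to_base[u uK ux] /to_base[v vK vy].
apply: connect_trans vy; apply: connect_trans (base_conn u v uK vK).
by rewrite e_sym.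
Qed.

Context (W : finType) (L : scomplex W) (f : smap K L).
Context (F : 'I_m.+1 -> nat -> V -> W) (w : 'I_m.+1 -> W).
Context (F0 : forall j, F j 0 =1 f).
Context (FN : forall j k v,
  N <= k -> v \in vertices (U j) -> F j k v = w j).
Context (F_contiguous : forall j k t, t \in (U j : {set {set V}}) ->
  F j k @: t :|: F j k.+1 @: t \in (L : {set {set W}})).

(** The apex has [v0] as its last coordinate, which may lie outside [U j]; its value is therefore
    set to [w j] directly. *)
Let ext : {ffun VV -> W} :=
  [ffun x : VV => if x.1.2 == N :> nat then w x.1.1 else F x.1.1 x.1.2 x.2].

Let ext_lev j k v : v \in vertices (U j) -> ext (lev j k v) = F j k v.
Proof.
move=> vU; rewrite ffunE /= inordK ?ltnS ?geq_minr //.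
case: leqP => [Nk|kN]; last first.
  (* At level 0 the stored index is [ord0], but all the [F j 0] equal [f]. *)
  by rewrite ltn_eqF //; case: k kN => [|k] _ //=; rewrite !F0.
by rewrite eqxx FN // gtn_eqF // (leq_trans N_gt0).
Qed.

Lemma simplicial_ext : simplicial cones L ext.
Proof.
apply: simplicial_generated => _ /bigcupP[j _ /slabsP[k [t [tU ->]]]].
have extE i : ext @: (lev j i @: t) = F j i @: t.
  rewrite -imset_comp; apply: eq_in_imset => v vt /=.
  by rewrite ext_lev // (simplex_vertex tU).
by rewrite imsetU !extE F_contiguous.
Qed.

Lemma factor_through_cones :
  exists g : smap cones L, smap_comp g base = f.
Proof.
exists (SMap simplicial_ext); apply: smap_inj; apply/ffunP => v.
by rewrite !ffunE /= inordK ?min0n // leqn0 ltn_eqF // gtn_eqF // F0.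
Qed.

End LongCones.

(** * From a cover to a factorization *)

(* The empty complex is a legitimate member of a cover for [scat], but its
   identity is not null. *)
Lemma scat_cover_nonempty (V W : finType) (K : scomplex V) (L : scomplex W)
    (f : smap K L) n : edge_path_connected K -> scat_cover f n ->
  exists2 U : 'I_n.+1 -> subcomplex K, covers U &
    forall j, (U j : {set {set V}}) != set0 /\ null_smap (smap_restr f (U j)).
Proof.
case=> /set0Pn[v]; rewrite inE => vK _ [U covU nullU].
move: vK; rewrite -covU => /bigcupP[i _ vi].
pose r j := if (U j : {set {set V}}) == set0 then i else j.
exists (fun j => U (r j)).
  rewrite /covers -covU; apply/setP => s; apply/bigcupP/bigcupP => -[j _ sj].
    by exists (r j).
  by exists j => //; rewrite /r; case: eqP => // Uj0; rewrite Uj0 inE in sj.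
move=> j; split=> //; rewrite /r; case: ifPn => // _.
by apply/set0Pn; exists [set v].
Qed.

(** Length, constant value and chain form one tuple of plain functions, whose type does not depend
    on [U]; [choice] can then pick it for all members of a cover. *)
Lemma null_smap_seq (V W : finType) (K : scomplex V) (L : scomplex W)
    (f : smap K L) (U : subcomplex K) : null_smap (smap_restr f U) ->
  exists x : nat * W * (nat -> V -> W),
    [/\ x.2 0 =1 f,
      forall k v, x.1.1 <= k -> v \in vertices U -> x.2 k v = x.1.2 &
      forall k t, t \in (U : {set {set V}}) ->
        x.2 k @: t :|: x.2 k.+1 @: t \in (L : {set {set W}})].
Proof.
case=> c [w _ cw] /contiguity_class_natP[F cF [F0 [N FN]]].
exists (N, w, fun k => F k : V -> W); split=> /=.
- by move=> v; rewrite F0.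
- by move=> k v /FN-> /cw.
- by move=> k t tU; apply: (forall_inP (cF k)).
Qed.

Lemma scat_cover_cones (V W : finType) (K : scomplex V) (L : scomplex W)
    (f : smap K L) m : edge_path_connected K -> scat_cover f m ->
  exists (V' : finType) (K' : scomplex V'),
    edge_path_connected K' /\ gscat_cover K' m /\
    exists (l : smap K K') (g : smap K' L), smap_comp g l = f.
Proof.
move=> hK /(scat_cover_nonempty hK)[U covU nullU].
have /choice[x xP] : forall j, _ := fun j => null_smap_seq (nullU j).2.
have [/set0Pn[v0 _] _] := hK.
(* A common length for all the chains; the successor makes it positive. *)
pose N := (\max_j (x j).1.1).+1.
exists _, (cones N v0 U); split; first exact: cones_connected.
split.
  exists (long_cone N v0 U); first exact: long_cone_cover.
  by move=> j; apply: null_long_cone => //; case: (nullU j).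
exists (base v0 (ltn0Sn _ : 0 < N) covU).
apply: (factor_through_cones _ _ _ (F := fun j => (x j).2)
  (w := fun j => (x j).1.2)).
- by move=> j; case: (xP j).
- move=> j k v Nk; have [_ xN _] := xP j; apply: xN.
  by apply: leq_trans Nk; rewrite leqW //; exact: (leq_bigmax j).
- by move=> j; case: (xP j).
Qed.

Theorem theorem19 (V W : finType) (K : scomplex V) (L : scomplex W)
    (hK : edge_path_connected K) (hL : edge_path_connected L)
    (f : smap K L) (n : nat) :
  scat f <= n <->
  exists (V' : finType) (K' : scomplex V'),
    edge_path_connected K' /\ gscat K' <= n /\
    exists (l : smap K K') (g : smap K' L),
      contiguity_class (smap_comp g l) f.
Proof.
have [scatP scat_min] := scat_coverP f hK; split=> [fn|].
  (* The construction is applied to an optimal cover, with [scat f] in place of [n], which avoids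
     padding covers. *)
  have [V' [K' [hK' [covK' [l [g glf]]]]]] := scat_cover_cones hK scatP.
  exists V', K'; split=> //; split.
    by apply: leq_trans fn; apply: (gscat_coverP hK').2.
  by exists l, g; exists [::].
move=> [V' [K' [hK' [K'n [l [g glf]]]]]]; apply: leq_trans K'n.
by apply: scat_min; apply: scat_cover_factor glf (gscat_coverP hK').1.
Qed.
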